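(* Let $M,K\subset\{1,\dots,n\}$. The following statements are equivalent: (a) $K\prec M$ (i.e. $W_M^-\cap W_K^+\neq\emptyset$); (b) $W_K^-\subset\overline{W_M^-}$ (closure in $\mathrm{Lag}_h(\widehat E)$).
   Context: $E$ is a complex Hermitian vector space of dimension $n$ with a fixed orthonormal basis $e_1,\dots,e_n$; $\widehat E=E\oplus E$, $\mathbf e_i=(e_i,0)$, $\mathbf f_i=(0,e_i)$, $J(x,y)=(-y,x)$. $\mathrm{Lag}_h(\widehat E)$ is the set of complex subspaces $L\subset\widehat E$ with $L^\perp=JL$, topologized as a subset of the Grassmannian of $n$-dimensional subspaces of $\widehat E$. For $I\subset\{1,\dots,n\}$ with complement $I^c$ put $\Lambda_I=\mathrm{span}_{\mathbb C}\{\mathbf e_i,\mathbf f_j:i\in I,\ j\in I^c\}$. Fix reals $0<\alpha_1<\cdots<\alpha_n$, let $\widehat A\mathbf e_i=\alpha_i\mathbf e_i$, $\widehat A\mathbf f_i=-\alpha_i\mathbf f_i$, $\Psi^t(L)=e^{t\widehat A}L$, and $W_I^\pm=\{L\in\mathrm{Lag}_h(\widehat E):\lim_{t\to\infty}e^{\pm t\widehat A}L=\Lambda_I\}$. $K\prec M$ means that there is some $L\in\mathrm{Lag}_h(\widehat E)$ with $\lim_{t\to\infty}\Psi^{-t}L=\Lambda_M$ and $\lim_{t\to\infty}\Psi^tL=\Lambda_K$; equivalently $W_M^-\cap W_K^+\ne\emptyset$. *)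

(* Defs.v *)
From HB Require Import structures.
From mathcomp Require Import all_boot all_order all_algebra.
From mathcomp Require Import complex.
From mathcomp Require Import all_classical all_reals all_analysis.

Set Implicit Arguments.
Unset Strict Implicit.
Unset Printing Implicit Defensive.

Import Order.TTheory GRing.Theory Num.Theory Num.Def.
Import numFieldNormedType.Exports.

Local Open Scope ring_scope.
Local Open Scope complex_scope.
Local Open Scope classical_set_scope.

Section Operators.
Variables (C : numClosedFieldType) (N : nat).

Definition expmx (A : 'M[C]_N) : 'M[C]_N :=
  limn (series (fun k : nat => (k`!%:R)^-1 *: A ^+ k)).

Variables (V : vectType C) (b : N.-tuple V).

(* Coordinates are row vectors: row [i] of the matrix of [f] holds the
   coordinates of [f b_i]. *)
Definition mx_of_lfun (f : 'End(V)) : 'M[C]_N :=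
  \matrix_(i, j) coord b j (f (tnth b i)).

Definition lfun_of_mx (A : 'M[C]_N) : 'End(V) :=
  linfun (fun v => \sum_i \sum_j (coord b i v * A i j) *: tnth b j).

Definition exp_lfun (f : 'End(V)) : 'End(V) :=
  lfun_of_mx (expmx (mx_of_lfun f)).

Variable form : {dot V for conjC}.

Definition orthoproj (L : {vspace V}) : 'End(V) := daddv_pi L (orthov form L).

(* All the subspaces of [V], with the topology that makes
   [L |-> orthogonal projection onto L] an embedding into ['End(V)]. As
   [\dim L] is the trace of the projection, this is the disjoint union of the
   Grassmannians [Gr_k(V)], each of them open and closed and carrying its usual
   topology. *)
Definition Grass : Type :=
  initial_topology (fun L : {vspace V} => mx_of_lfun (orthoproj L)).

End Operators.

Section HermitianDouble.
Variables (C : numClosedFieldType) (E : vectType C) (form : {dot E for conjC}).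

Definition hat_form (u v : E * E) : C := form u.1 v.1 + form u.2 v.2.

Let hat_form_linearl v : linear_for *%R (hat_form^~ v).
Proof. by move=> a x y; rewrite /hat_form /= !linearPl /= mulrDr addrACA. Qed.

Let hat_form_linearr u : linear_for (conjC \; *%R) (hat_form u).
Proof. by move=> a x y; rewrite /hat_form /= !linearPr /= mulrDr addrACA. Qed.

HB.instance Definition _ := bilinear_isBilinear.Build _ _ _ _ _ _ hat_form
  (hat_form_linearl, hat_form_linearr).

Let hat_form_hermitian u v :
  hat_form u v = (-1) ^+ false * conjC (hat_form v u).
Proof.
rewrite /hat_form expr0 mul1r rmorphD /=.
by rewrite (hermC form u.1) (hermC form u.2) !expr0 !mul1r.
Qed.

HB.instance Definition _ :=
  isHermitianSesquilinear.Build _ _ false conjC hat_form hat_form_hermitian.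

Let hat_form_gt0 u : u != 0 -> 0 < hat_form u u.
Proof.
case: u => x y; rewrite /hat_form /=.
have ge0 (z : E) : 0 <= form z z.
  by have [->|/neq0_dnorm_gt0/ltW//] := eqVneq z 0; rewrite linear0l.
have [->|/neq0_dnorm_gt0 x_gt0 _] := eqVneq x 0; last exact: ltr_wpDr.
by rewrite xpair_eqE eqxx /= => /neq0_dnorm_gt0; rewrite linear0l add0r.
Qed.

HB.instance Definition _ := isDotProduct.Build _ _ hat_form hat_form_gt0.

Definition hatJ (v : E * E) : E * E := (- v.2, v.1).

Let hatJ_linear : linear hatJ.
Proof. by move=> a [x y] [x' y']; rewrite /hatJ /= opprD -scalerN. Qed.

HB.instance Definition _ :=
  GRing.isLinear.Build C (E * E)%type (E * E)%type *:%R hatJ hatJ_linear.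

End HermitianDouble.

Section Lagrangians.
Variables (C : numClosedFieldType) (n : nat) (E : vectType C).
Variables (form : {dot E for conjC}) (e : n.-tuple E).

Definition bfe (i : 'I_n) : E * E := (tnth e i, 0).
Definition bff (i : 'I_n) : E * E := (0, tnth e i).

Definition hat_basis : (n + n).-tuple (E * E) :=
  [tuple of map_tuple bfe (ord_tuple n) ++ map_tuple bff (ord_tuple n)].

Definition hatGrass : Type := Grass hat_basis (hat_form form).

Definition Lag : set hatGrass :=
  [set L : {vspace E * E} |
    orthov (hat_form form) L = (linfun (@hatJ C E) @: L)%VS].

Definition closure_Lag (A : set hatGrass) : set hatGrass := closure A `&` Lag.

Definition Lambda (I : {set 'I_n}) : hatGrass :=
  <<[seq bfe i | i <- enum I] ++ [seq bff j | j <- enum (~: I)]>>%VS.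

End Lagrangians.

Arguments Lag {C n E} form e _.
Arguments closure_Lag {C n E form e} A _.

Section Flow.
Variables (R : realType) (n : nat) (E : vectType R[i]).
Variables (form : {dot E for conjC}) (e : n.-tuple E).
Variable Ahat : 'End((E * E)%type).

Definition Psi (t : R) (L : hatGrass form e) : hatGrass form e :=
  (exp_lfun (hat_basis e) (t%:C *: Ahat) @: (L : {vspace E * E}))%VS.

Definition Wplus (I : {set 'I_n}) : set (hatGrass form e) :=
  [set L | Lag form e L /\ Psi t L @[t --> +oo] --> Lambda form e I].

Definition Wminus (I : {set 'I_n}) : set (hatGrass form e) :=
  [set L | Lag form e L /\ Psi (- t) L @[t --> +oo] --> Lambda form e I].

Definition prec (K M : {set 'I_n}) : Prop :=
  exists L : hatGrass form e, [/\ Lag form e L,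
    Psi (- t) L @[t --> +oo] --> Lambda form e M &
    Psi t L @[t --> +oo] --> Lambda form e K].

End Flow.

Arguments Wplus {R n E} form e Ahat I _.
Arguments Wminus {R n E} form e Ahat I _.

(* Main.v *)
From HB Require Import structures.
Require Import Defs.
From mathcomp Require Import all_boot all_order all_algebra.
From mathcomp Require Import complex.
From mathcomp Require Import all_classical all_reals all_analysis.
Import Order.TTheory GRing.Theory Num.Theory Num.Def.
Import numFieldNormedType.Exports.
Local Open Scope ring_scope.
Local Open Scope complex_scope.
Local Open Scope classical_set_scope.

(* A Lagrangian L is encoded by the matrix of its orthogonal projection, whose
   row space consists of the coordinates of L. An invertible matrix g acts on
   subspaces by L |-> L g, jointly continuously in (g, L).
   Near Lambda_K the Lagrangians are the graphs of the S : Lambda_K ->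
   Lambda_K^perp with S J + J S^* = 0, and the flow multiplies each entry of S
   by an exponential, so that S = S_- + S_+ splits into the parts tangent to
   W_K^- and W_K^+. In this chart the shears 1 + T with T = T_- act by the
   translations S |-> S + T; they preserve the Lagrangians, and also W_M^- for
   every M since the flow contracts them to 1. Hence:
   - if L connects M to K and L' in W_K^- is the graph of T, the points
     (Psi^t L)(1 + T) of W_M^- converge to Lambda_K (1 + T) = L';
   - if Lambda_K is a limit of W_M^-, some graph of S lies in W_M^-, and the
     shear 1 - S_- moves it to the graph of S_+, which is in W_M^- and W_K^+. *)

Set Implicit Arguments.
Unset Strict Implicit.
Unset Printing Implicit Defensive.
Local Open Scope sesquilinear_scope.

(** * Continuity of matrix operations *)

Section MatrixTopology.
Context {C : numClosedFieldType} {T : Type} {F : set_system T} {FF : Filter F}.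

Lemma cvg_mxP m n (f : T -> 'M[C]_(m, n)) (A : 'M[C]_(m, n)) :
  f @ F --> A <-> forall i j, f x i j @[x --> F] --> A i j.
Proof.
split=> [fA i j|fA].
  exact: (cvg_comp _ _ fA (@coord_continuous _ _ _ i j A)).
apply/cvg_mx_entourageP => E entE.
have : \forall x \near F, forall ij : 'I_m * 'I_n,
    (A ij.1 ij.2, f x ij.1 ij.2) \in E.
  apply: (@filter_forall T _
    (fun ij x => (A ij.1 ij.2, f x ij.1 ij.2) \in E) F FF) => -[i j] /=.
  have : F ((fun x => f x i j) @^-1` xsection E (A i j)).
    exact: fA (nbhs_entourage (A i j) entE).
  by apply: filterS => x /xsectionP; rewrite inE.
by apply: filterS => x H i j; exact: (H (i, j)).
Qed.

Lemma cvg_mulmx m n p (f : T -> 'M[C]_(m, n)) (g : T -> 'M[C]_(n, p))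
    (A : 'M[C]_(m, n)) (B : 'M[C]_(n, p)) :
  f @ F --> A -> g @ F --> B -> (f x *m g x) @[x --> F] --> A *m B.
Proof.
move=> /cvg_mxP fA /cvg_mxP gB; apply/cvg_mxP => i k.
under eq_fun do rewrite mxE; rewrite mxE.
apply: cvg_big => [|j _]; first exact: add_continuous.
by apply: cvgM; [exact: fA|exact: gB].
Qed.

Lemma cvg_trmxC m n (f : T -> 'M[C]_(m, n)) (A : 'M[C]_(m, n)) :
  f @ F --> A -> (f x)^t* @[x --> F] --> A^t*.
Proof.
move=> /cvg_mxP fA; apply/cvg_mxP => i j.
under eq_fun do rewrite !mxE; rewrite !mxE.
apply/cvgrPdist_lt => e e0; have /cvgrPdist_lt/(_ _ e0) := fA j i.
by apply: filterS => x; rewrite -rmorphB norm_conjC.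
Qed.

Lemma cvg_det n (f : T -> 'M[C]_n) (A : 'M[C]_n) :
  f @ F --> A -> \det (f x) @[x --> F] --> \det A.
Proof.
move=> /cvg_mxP fA; apply: cvg_big => [|s _]; first exact: add_continuous.
apply: cvgM; first exact: cvg_cst.
by apply: cvg_big => [|i _]; [exact: mul_continuous|exact: fA].
Qed.

Lemma near_unitmx n (f : T -> 'M[C]_n) (A : 'M[C]_n) :
  f @ F --> A -> A \in unitmx -> \forall x \near F, f x \in unitmx.
Proof.
move=> fA; rewrite unitmxE unitfE => detA0.
have := cvg_det fA; move/cvgr_neq0 => /(_ detA0).
by apply: filterS => x; rewrite unitmxE unitfE.
Qed.

Lemma cvg_invmx n (f : T -> 'M[C]_n) (A : 'M[C]_n) :
  f @ F --> A -> A \in unitmx -> invmx (f x) @[x --> F] --> invmx A.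
Proof.
move=> fA uA; have detA0 : \det A != 0 by rewrite -unitfE -unitmxE.
have -> : invmx A = (\det A)^-1 *: \adj A by rewrite /invmx uA.
have : ((\det (f x))^-1 *: \adj (f x)) @[x --> F] --> (\det A)^-1 *: \adj A.
  apply: cvgZ; first exact: cvgV (cvg_det fA).
  apply/cvg_mxP => i j; under eq_fun do rewrite mxE; rewrite mxE.
  apply: cvgM; first exact: cvg_cst.
  apply: cvg_det; apply/cvg_mxP => k l.
  under eq_fun do rewrite !mxE; rewrite !mxE.
  by move/cvg_mxP : fA; exact.
(* On singular matrices [invmx] is the identity map, so the adjugate formula for [invmx (f x)] holds
   only eventually along [F]. *)
apply: cvg_trans; apply: near_eq_cvg.
by apply: filterS (near_unitmx fA uA) => x ux; rewrite /invmx ux.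
Qed.

End MatrixTopology.

(** * Orthogonal projections and their images under invertible matrices *)

Lemma trmxCM (C : numClosedFieldType) m n p
    (A : 'M[C]_(m, n)) (B : 'M[C]_(n, p)) :
  (A *m B)^t* = B^t* *m A^t*.
Proof. by rewrite trmx_mul map_mxM. Qed.

Lemma trmxC_eq0 (C : numClosedFieldType) m n (A : 'M[C]_(m, n)) :
  A^t* = 0 -> A = 0.
Proof. by move/(congr1 (fun X => X^t* )); rewrite trmxCK trmx0 map_mx0. Qed.

Section OrthogonalProjections.
Variables (C : numClosedFieldType) (N : nat).
Implicit Types P Q g J S : 'M[C]_N.

Definition orthoprojmx P := P^t* = P /\ P *m P = P.

Lemma orthoprojmxC P : orthoprojmx P -> orthoprojmx (1%:M - P).
Proof.
move=> [PC PP]; split.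
  by rewrite !raddfB /= trmx1 map_mx1 PC.
by rewrite mulmxBl mulmxBr !mul1mx mulmxBr !mulmx1 PP subrr subr0.
Qed.

Lemma submx_orthoproj P m (A : 'M[C]_(m, N)) :
  orthoprojmx P -> reflect (A *m P = A) (A <= P)%MS.
Proof.
move=> [_ PP]; apply: (iffP idP) => [/submxP[D ->]|<-]; last exact: submxMl.
by rewrite -mulmxA PP.
Qed.

Lemma submx_orthoprojC P m (A : 'M[C]_(m, N)) :
  orthoprojmx P -> reflect (A *m P = 0) (A <= 1%:M - P)%MS.
Proof.
move=> oP; apply: (iffP (submx_orthoproj _ (orthoprojmxC oP))).
  move=> /eqP; rewrite mulmxBr mulmx1 -subr_eq0 addrAC subrr sub0r oppr_eq0.
  by move/eqP.
by move=> AP; rewrite mulmxBr mulmx1 AP subr0.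
Qed.

(** Equal row spaces give P Q = P and Q P = Q; taking adjoints in the first identity yields P = Q P
    = Q. *)
Lemma orthoprojmx_inj P Q :
  orthoprojmx P -> orthoprojmx Q -> (P :=: Q)%MS -> P = Q.
Proof.
move=> oP oQ PQ.
have /(submx_orthoproj _ oQ) PQE : (P <= Q)%MS by rewrite PQ.
have /(submx_orthoproj _ oP) QPE : (Q <= P)%MS by rewrite PQ.
by rewrite -[LHS]oP.1 -PQE trmxCM oP.1 oQ.1 QPE.
Qed.

Lemma eqmx_unitl m (u : 'M[C]_m) (A : 'M[C]_(m, N)) :
  u \in unitmx -> (u *m A :=: A)%MS.
Proof. by move=> uu; apply: eqmxMfull; rewrite row_full_unit. Qed.

Lemma unitmx_trmxC g : g \in unitmx -> (g^t* ) \in unitmx.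
Proof. by move=> ug; rewrite map_unitmx unitmx_tr. Qed.

Lemma invmx_trmxC g : invmx (g^t* ) = (invmx g)^t*.
Proof. by rewrite trmx_inv map_invmx. Qed.

(** Let h be the adjoint of the inverse of g. The Hermitian product of x g and y h equals that of x
    and y, so h carries orthogonal complements to orthogonal complements when g moves the
    subspaces. *)
Lemma eqmx_orthoC P Q g : orthoprojmx P -> orthoprojmx Q -> g \in unitmx ->
  (P *m g :=: Q)%MS -> ((1%:M - P) *m (invmx g)^t* :=: 1%:M - Q)%MS.
Proof.
move=> oP oQ ug PgQ; apply/eqmxP/andP; split.
  apply/(submx_orthoprojC _ oQ).
  have : (Q *m invmx g <= P)%MS by rewrite -[P](mulmxK ug) submxMr ?PgQ.
  move=> /(submx_orthoproj _ oP) QgP.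
  apply: trmxC_eq0; rewrite !trmxCM trmxCK oQ.1.
  by rewrite (orthoprojmxC oP).1 mulmxA mulmxBr mulmx1 QgP subrr.
have : ((1%:M - Q) *m g^t* <= 1%:M - P)%MS.
  apply/(submx_orthoprojC _ oP).
  have /(submx_orthoproj _ oQ) PgE : (P *m g <= Q)%MS by rewrite PgQ.
  apply: trmxC_eq0; rewrite !trmxCM trmxCK oP.1.
  by rewrite (orthoprojmxC oQ).1 mulmxA mulmxBr mulmx1 PgE subrr.
move=> /(submxMr ((invmx g)^t* )).
by rewrite -invmx_trmxC mulmxK // unitmx_trmxC.
Qed.

(* It maps the row space of P to that of P g and the orthogonal complement of
   the former to that of the latter, so that it conjugates the two orthogonal
   projections; it is continuous in (P, g). *)
Definition conjugator P g := P *m g + (1%:M - P) *m (invmx g)^t*.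

Lemma conjugatorP P Q g : orthoprojmx P -> orthoprojmx Q -> g \in unitmx ->
  (P *m g :=: Q)%MS ->
  conjugator P g \in unitmx /\ conjugator P g *m Q = P *m conjugator P g.
Proof.
move=> oP oQ ug PgQ; have PgcQ := eqmx_orthoC oP oQ ug PgQ.
have /(submx_orthoproj _ oQ) e1 : (P *m g <= Q)%MS by rewrite PgQ.
have /(submx_orthoprojC _ oQ) e2 : ((1%:M - P) *m (invmx g)^t* <= 1%:M - Q)%MS.
  by rewrite PgcQ.
have ZQ : conjugator P g *m Q = P *m g by rewrite mulmxDl e1 e2 addr0.
split; last first.
  rewrite ZQ /conjugator mulmxDr !mulmxA mulmxBr mulmx1 oP.2 subrr mul0mx.
  by rewrite addr0.
(* The inverse is the conjugator in the opposite direction, from Q back to P along [invmx g]. *)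
have : conjugator P g *m (Q *m invmx g + (1%:M - Q) *m g^t*) = 1%:M.
  rewrite mulmxDr !mulmxA mulmxBr ZQ mulmx1 mulmxK //.
  rewrite {1}/conjugator [P *m g + _]addrC addrK -mulmxA -trmxCM mulmxV //.
  by rewrite trmx1 map_mx1 mulmx1 addrC subrK.
by case/mulmx1_unit.
Qed.

End OrthogonalProjections.

(** With Z the conjugator of P and g, the projection Q is Z^-1 P Z, which is continuous in (P, g)
    where g is invertible. Since g0 is invertible, this formula holds eventually along [F]. *)
Lemma cvg_orthoproj (C : numClosedFieldType) N T (F : set_system T)
    (FF : Filter F) (P Q g : T -> 'M[C]_N) (P0 Q0 g0 : 'M[C]_N) :
    (forall x, orthoprojmx (P x)) -> (forall x, orthoprojmx (Q x)) ->
    orthoprojmx P0 -> orthoprojmx Q0 -> g0 \in unitmx ->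
    (forall x, g x \in unitmx -> (P x *m g x :=: Q x)%MS) ->
    (P0 *m g0 :=: Q0)%MS ->
  P @ F --> P0 -> g @ F --> g0 -> Q @ F --> Q0.
Proof.
move=> oP oQ oP0 oQ0 ug0 PgQ PgQ0 cP cg.
have QE (R R' h : 'M[C]_N) : orthoprojmx R -> orthoprojmx R' -> h \in unitmx ->
    (R *m h :=: R')%MS ->
    R' = invmx (conjugator R h) *m (R *m conjugator R h).
  move=> oR oR' uh /(conjugatorP oR oR' uh)[uZ <-].
  by rewrite mulKmx.
have cZ : conjugator (P x) (g x) @[x --> F] --> conjugator P0 g0.
  apply: cvgD; first exact: cvg_mulmx.
  apply: cvg_mulmx; first by apply: cvgB => //; exact: cvg_cst.
  exact/cvg_trmxC/cvg_invmx.
have [uZ0 _] := conjugatorP oP0 oQ0 ug0 PgQ0.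
rewrite (QE _ _ _ oP0 oQ0 ug0 PgQ0).
have : (invmx (conjugator (P x) (g x)) *m (P x *m conjugator (P x) (g x)))
    @[x --> F] --> invmx (conjugator P0 g0) *m (P0 *m conjugator P0 g0).
  by apply: cvg_mulmx; [exact: cvg_invmx|exact: cvg_mulmx].
apply: cvg_trans; apply: near_eq_cvg.
apply: filterS (near_unitmx cg ug0) => x ux.
by rewrite -(QE _ _ _ (oP x) (oQ x) ux (PgQ x ux)).
Qed.

(** * Graphs *)

Section Graphs.
Variables (C : numClosedFieldType) (N : nat) (P0 : 'M[C]_N).
Hypothesis oP0 : orthoprojmx P0.
Implicit Types P S g : 'M[C]_N.

(* The subspaces that are graphs over the row space of P0 are the row spaces of
   the P0 + S with [graphmx S]. *)
Definition graphmx S := P0 *m S = S /\ S *m P0 = 0.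

Lemma graphmx_mul0 S S' : graphmx S -> graphmx S' -> S *m S' = 0.
Proof. by move=> [_ SP0] [<- _]; rewrite mulmxA SP0 mul0mx. Qed.

Lemma graphmxN S : graphmx S -> graphmx (- S).
Proof. by move=> [e1 e2]; split; rewrite ?mulmxN ?mulNmx ?e1 ?e2 ?oppr0. Qed.

Lemma graphmxD S S' : graphmx S -> graphmx S' -> graphmx (S + S').
Proof.
move=> [e1 e2] [f1 f2].
by split; rewrite ?mulmxDr ?mulmxDl ?e1 ?e2 ?f1 ?f2 ?addr0.
Qed.

Lemma graphmx_shear S : graphmx S -> P0 *m (1%:M + S) = P0 + S.
Proof. by move=> [e1 _]; rewrite mulmxDr mulmx1 e1. Qed.

Lemma graphmx_shearD S S' : graphmx S -> graphmx S' ->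
  (P0 + S) *m (1%:M + S') = P0 + (S + S').
Proof.
move=> gS gS'; rewrite mulmxDl graphmx_shear // mulmxDr mulmx1.
by rewrite (graphmx_mul0 gS gS') addr0 -addrA [S' + S]addrC.
Qed.

Lemma graphmx_unit S : graphmx S -> 1%:M + S \in unitmx.
Proof.
move=> gS; have : (1%:M + S) *m (1%:M - S) = 1%:M.
  rewrite mulmxBr mulmx1 mulmxDl mul1mx (graphmx_mul0 gS gS) addr0.
  by rewrite addrK.
by case/mulmx1_unit.
Qed.

Lemma graphmx_inj S S' : graphmx S -> graphmx S' ->
  ((P0 + S)%R :=: (P0 + S')%R)%MS -> S = S'.
Proof.
move=> [e1 e2] [f1 f2] SS'.
(* Write P0 + S = u (P0 + S'). Multiplying by P0 on the right kills S and S' and leaves P0 = u P0,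
   so u also fixes S' = P0 S'. *)
have /submxP[u uE] : ((P0 + S)%R <= (P0 + S')%R)%MS by rewrite SS'.
have uP0 : u *m P0 = P0.
  have : (P0 + S) *m P0 = u *m ((P0 + S') *m P0) by rewrite mulmxA -uE.
  by rewrite !mulmxDl e2 f2 !addr0 oP0.2 => <-.
apply: (addrI P0); rewrite uE mulmxDr uP0; congr (_ + _).
by rewrite -{1}f1 mulmxA uP0 f1.
Qed.

(** The compression of P to the row space of P0, completed by the identity on the orthogonal
    complement so that it can be inverted as a full square matrix. *)
Let corner P := P0 *m P *m P0 + (1%:M - P0).

(* For P close to P0, the graph of chart P is the row space of P0 P, which is
   that of P. *)
Definition chart P := invmx (corner P) *m (P0 *m P *m (1%:M - P0)).

Let corner_comm P : P0 *m corner P = corner P *m P0.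
Proof.
rewrite /corner mulmxDr mulmxDl !mulmxA oP0.2 mulmxBl mulmxBr mul1mx mulmx1.
by rewrite -!mulmxA oP0.2.
Qed.

Lemma chart_graphmx P : corner P \in unitmx -> graphmx (chart P).
Proof.
move=> uG; split; rewrite /chart.
  have -> : P0 *m (invmx (corner P) *m (P0 *m P *m (1%:M - P0))) =
     invmx (corner P) *m P0 *m (P0 *m P *m (1%:M - P0)).
    rewrite mulmxA; congr (_ *m _).
    by rewrite -{1}[P0](mulKmx uG) -corner_comm mulmxA mulmxK.
  by rewrite -mulmxA !mulmxA -[_ *m P0 *m P0]mulmxA oP0.2.
by rewrite -!mulmxA mulmxBl mul1mx oP0.2 subrr !mulmx0.
Qed.

Lemma chartE P : corner P \in unitmx ->
  P0 + chart P = invmx (corner P) *m (P0 *m P).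
Proof.
move=> uG; rewrite /chart mulmxBr mulmx1 mulmxBr.
suff <- : P0 = invmx (corner P) *m (P0 *m P *m P0) by rewrite addrC subrK.
rewrite -{1}[P0](mulKmx uG); congr (_ *m _).
by rewrite /corner mulmxDl mulmxBl mul1mx oP0.2 subrr addr0 -!mulmxA oP0.2.
Qed.

Lemma near_chart T (F : set_system T) (FF : Filter F) (f : T -> 'M[C]_N) :
  (forall x, orthoprojmx (f x)) -> f @ F --> P0 ->
  \forall x \near F, graphmx (chart (f x)) /\ ((P0 + chart (f x))%R :=: f x)%MS.
Proof.
move=> of_ cf.
have cG : corner (f x) @[x --> F] --> corner P0.
  apply: cvgD; last exact: cvg_cst.
  apply: cvg_mulmx; last exact: cvg_cst.
  by apply: cvg_mulmx => //; exact: cvg_cst.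
(* This matrix X satisfies X P = P0 P for P = f x, so once it is invertible P0 P and P have the same
   row space. Both X and the corner are 1 at P = P0, hence invertible nearby. *)
have cX : P0 *m f x + (1%:M - P0) *m (1%:M - f x) @[x --> F] -->
          P0 *m P0 + (1%:M - P0) *m (1%:M - P0).
  apply: cvgD; first by apply: cvg_mulmx => //; exact: cvg_cst.
  apply: cvg_mulmx; first exact: cvg_cst.
  by apply: cvgB => //; exact: cvg_cst.
have corner1 : corner P0 = 1%:M by rewrite /corner !oP0.2 addrC subrK.
have X1 : P0 *m P0 + (1%:M - P0) *m (1%:M - P0) = 1%:M.
  by rewrite oP0.2 (orthoprojmxC oP0).2 addrC subrK.
have nG := near_unitmx cG; have nX := near_unitmx cX.
rewrite corner1 in nG; rewrite X1 in nX.
move: (nG FF (unitmx1 _ _)) (nX FF (unitmx1 _ _)); apply: filterS2 => x uG uX.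
split; first exact: chart_graphmx.
rewrite chartE //; apply: eqmx_trans.
  by apply: eqmx_unitl; rewrite unitmx_inv.
apply/eqmxP/andP; split; first exact: submxMl.
have XP : (P0 *m f x + (1%:M - P0) *m (1%:M - f x)) *m f x = P0 *m f x.
  rewrite mulmxDl -!mulmxA (of_ x).2
    [(1%:M - f x) *m _]mulmxBl mul1mx (of_ x).2 subrr.
  by rewrite mulmx0 addr0.
by rewrite -{1}[f x](mulKmx uX) XP submxMl.
Qed.

Lemma cvg_chart T (F : set_system T) (FF : Filter F) (f : T -> 'M[C]_N) :
  f @ F --> P0 -> chart (f x) @[x --> F] --> (0 : 'M[C]_N).
Proof.
move=> cf.
have corner1 : corner P0 = 1%:M by rewrite /corner !oP0.2 addrC subrK.
have -> : 0 = chart P0.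
  by rewrite /chart mulmxBr mulmx1 !oP0.2 subrr mulmx0.
apply: cvg_mulmx.
  apply: cvg_invmx; last by rewrite corner1 unitmx1.
  apply: cvgD; last exact: cvg_cst.
  apply: cvg_mulmx; last exact: cvg_cst.
  by apply: cvg_mulmx => //; exact: cvg_cst.
apply: cvg_mulmx; last exact: cvg_cst.
by apply: cvg_mulmx => //; exact: cvg_cst.
Qed.

End Graphs.

(** * Coordinates in an orthonormal basis *)

Section OrthogonalDecomposition.
Variables (C : numClosedFieldType) (V : vectType C) (form : {dot V for conjC}).
Implicit Types (L : {vspace V}) (u v : V).

Lemma capv_orthov L : (L :&: orthov form L = 0)%VS.
Proof.
apply/eqP; rewrite -subv0; apply/subvP => v; rewrite memv_cap => /andP[vL].
by move=> /mem_orthovP/(_ _ vL)/eqP; rewrite dnorm_eq0 memv0.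
Qed.

(** Orthogonality to each vector of [us] is one linear condition, which lowers the dimension by at
    most one. *)
Lemma leq_dim_cap_orthov_span L (us : seq V) :
  (\dim L <= \dim (L :&: orthov form <<us>>)%VS + size us)%N.
Proof.
elim: us L => [|u us IHus] L.
  by rewrite span_nil orthov0 capvf addn0.
have -> : (L :&: orthov form <<u :: us>> =
           (L :&: orthov form <[u]>) :&: orthov form <<us>>)%VS.
  rewrite -capvA; congr (_ :&: _)%VS; apply/vspaceP => v.
  rewrite memv_cap span_cons !memvE orthov_sym orthoDv.
  by rewrite ![(_ <= orthov _ <[v]>)%VS]orthov_sym.
rewrite /= addnS.
apply: leq_trans (_ : (\dim (L :&: orthov form <[u]>)%VS).+1 <= _)%N.
  by have := leq_dim_orthov1 form u L; case: (\dim L).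
by rewrite ltnS.
Qed.

(** The sum is direct, and the preceding bound, applied to a basis of L, shows that the complement
    is large enough to fill the space. *)
Lemma addv_orthov L : (L + orthov form L = fullv)%VS.
Proof.
apply/eqP; rewrite eqEdim subvf /= dimv_disjoint_sum ?capv_orthov //.
have := leq_dim_cap_orthov_span fullv (vbasis L).
by rewrite capfv (span_basis (vbasisP L)) size_tuple addnC.
Qed.

Lemma memv_orthoproj L v : orthoproj form L v \in L.
Proof. exact: memv_pi. Qed.

Lemma orthoproj_id L v : v \in L -> orthoproj form L v = v.
Proof. exact/daddv_pi_id/capv_orthov. Qed.

Lemma memv_orthov_sub L v : v - orthoproj form L v \in orthov form L.
Proof.
have E : orthoproj form L v + daddv_pi (orthov form L) L v = v.
  by apply: daddv_pi_add; rewrite ?capv_orthov // addv_orthov memvf.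
by rewrite -{1}E [X in X - _]addrC addrK memv_pi.
Qed.

Lemma orthoproj_orthov L v : v \in orthov form L -> orthoproj form L v = 0.
Proof.
move=> vL; apply/eqP; rewrite -memv0 -(capv_orthov L) memv_cap memv_orthoproj.
by rewrite -[orthoproj _ _ v](subKr v) rpredB ?memv_orthov_sub.
Qed.

Lemma orthoproj_selfadjoint L u v :
  form (orthoproj form L u) v = form u (orthoproj form L v).
Proof.
have orth x y : x \in L -> y \in orthov form L -> form x y = 0.
  move=> xL /mem_orthovP/(_ _ xL) yx; apply/eqP.
  by rewrite herm_eq0C yx.
transitivity (form (orthoproj form L u) (orthoproj form L v)).
  rewrite -{1}[v](subrK (orthoproj form L v)) linearDr /=.
  by rewrite orth ?add0r // ?memv_orthoproj ?memv_orthov_sub.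
rewrite -{2}[u](subrK (orthoproj form L u)) linearDl /=.
have /mem_orthovP -> := memv_orthov_sub L u; first by rewrite add0r.
exact: memv_orthoproj.
Qed.

End OrthogonalDecomposition.

Section Coordinates.
Variables (C : numClosedFieldType) (V : vectType C) (N : nat) (b : N.-tuple V).
Hypothesis b_basis : basis_of fullv b.

Definition coords (v : V) : 'rV[C]_N := \row_i coord b i v.
Definition of_coords (x : 'rV[C]_N) : V := \sum_i x 0 i *: tnth b i.

Lemma coordsK : cancel coords of_coords.
Proof.
move=> v; rewrite [RHS](coord_basis b_basis (memvf v)).
by apply: eq_bigr => i _; rewrite mxE (tnth_nth 0).
Qed.

Lemma of_coordsK : cancel of_coords coords.
Proof.
move=> x; apply/rowP => i; rewrite mxE.
rewrite -[RHS](coord_sum_free (x 0) i (basis_free b_basis)).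
by congr coord; apply: eq_bigr => j _; rewrite (tnth_nth 0).
Qed.

Lemma coords_tnth i : coords (tnth b i) = delta_mx 0 i.
Proof.
rewrite -[RHS]of_coordsK; congr coords; rewrite /of_coords (bigD1 i) //=.
rewrite mxE !eqxx scale1r big1 ?addr0 // => j /negPf ji.
by rewrite mxE eqxx ji scale0r.
Qed.

Lemma coords_lfun (f : 'End(V)) v : coords (f v) = coords v *m mx_of_lfun b f.
Proof.
apply/rowP => j; rewrite !mxE -{1}[v]coordsK /of_coords !linear_sum /=.
by apply: eq_bigr => i _; rewrite !linearZ /= !mxE.
Qed.

Lemma lfun_of_mxK (A : 'M[C]_N) : mx_of_lfun b (lfun_of_mx b A) = A.
Proof.
have lin : linear (fun v => \sum_i \sum_j (coord b i v * A i j) *: tnth b j).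
  move=> a u v; rewrite scaler_sumr -big_split; apply: eq_bigr => i _ /=.
  rewrite scaler_sumr -big_split; apply: eq_bigr => j _ /=.
  by rewrite linearP mulrDl scalerDl scalerA mulrA.
(* [lfun_of_mx] applies [linfun] to a bare function; packing that function as a linear map makes
   [lfunE] available. *)
pose g : {linear V -> V} :=
  HB.pack (fun v => _) (GRing.isLinear.Build _ _ _ _ _ lin).
apply/matrixP => k l; rewrite mxE -[lfun_of_mx b A]/(linfun g) lfunE /=.
rewrite (bigD1 k) //= [X in _ + X]big1 ?addr0 => [|i /negPf ik]; last first.
  rewrite big1 // => j _; have /rowP/(_ i) := coords_tnth k.
  by rewrite !mxE eqxx ik => ->; rewrite mul0r scale0r.
have /rowP/(_ k) := coords_tnth k; rewrite !mxE !eqxx => ->.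
have /rowP/(_ l) := of_coordsK (row k A); rewrite !mxE => <-.
by congr (coord b l _); apply: eq_bigr => j _; rewrite mxE mul1r.
Qed.

Lemma eqmx_coords (A B : 'M[C]_N) :
  (forall v, (coords v <= A)%MS = (coords v <= B)%MS) -> (A :=: B)%MS.
Proof.
move=> AB; apply/eqmxP/andP; split; apply/row_subP => i.
  by rewrite -[row i A]of_coordsK -AB of_coordsK row_sub.
by rewrite -[row i B]of_coordsK AB of_coordsK row_sub.
Qed.

Variable form : {dot V for conjC}.
Hypothesis b_orthonormal : forall i j, form (tnth b i) (tnth b j) = (i == j)%:R.
Implicit Types (L : {vspace V}) (u v : V).

Lemma coord_form v j : coord b j v = form v (tnth b j).
Proof.
rewrite -{2}[v]coordsK /of_coords linear_sumlz (bigD1 j) //=.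
rewrite big1 => [|i /negPf ij].
  by rewrite linearZl_LR /= b_orthonormal eqxx mulr1 addr0 mxE.
by rewrite linearZl_LR /= b_orthonormal ij mulr0.
Qed.

Definition projmx L := mx_of_lfun b (orthoproj form L).

Lemma orthoprojmx_projmx L : orthoprojmx (projmx L).
Proof.
split.
  apply/matrixP => i j; rewrite !mxE !coord_form orthoproj_selfadjoint.
  by rewrite [RHS]hermC expr0 mul1r.
apply/row_matrixP => i; rewrite row_mul !rowE -coords_tnth.
by rewrite -!coords_lfun orthoproj_id ?memv_orthoproj.
Qed.

Lemma submx_projmx L v : (coords v <= projmx L)%MS = (v \in L).
Proof.
apply/(submx_orthoproj _ (orthoprojmx_projmx L))/idP; rewrite -coords_lfun.
  by move/(can_inj coordsK) <-; exact: memv_orthoproj.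
by move=> vL; rewrite orthoproj_id.
Qed.

Lemma submx_projmxC L v :
  (coords v <= 1%:M - projmx L)%MS = (v \in orthov form L).
Proof.
have coords0 : coords 0 = 0 by apply/rowP => i; rewrite !mxE linear0.
apply/(submx_orthoprojC _ (orthoprojmx_projmx L))/idP; rewrite -coords_lfun.
  rewrite -coords0 => /(can_inj coordsK) v0.
  by have := memv_orthov_sub form L v; rewrite v0 subr0.
by move=> vL; rewrite orthoproj_orthov.
Qed.

Lemma submx_projmx_limg L f v :
  (coords v <= projmx L *m mx_of_lfun b f)%MS = (v \in f @: L)%VS.
Proof.
apply/submxP/memv_imgP => [[x vE]|[u uL ->]].
  exists (of_coords (x *m projmx L)).
    by rewrite -submx_projmx of_coordsK submxMl.
  by apply: (can_inj coordsK); rewrite coords_lfun of_coordsK vE mulmxA.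
have /submxP[x uE] : (coords u <= projmx L)%MS by rewrite submx_projmx.
by exists x; rewrite coords_lfun uE mulmxA.
Qed.

Lemma projmx_limg L f :
  (projmx L *m mx_of_lfun b f :=: projmx (f @: L))%MS.
Proof.
by apply: eqmx_coords => v; rewrite submx_projmx_limg submx_projmx.
Qed.

Lemma projmx_inj L L' : (projmx L :=: projmx L')%MS -> L = L'.
Proof. by move=> LL'; apply/vspaceP => v; rewrite -!submx_projmx LL'. Qed.

End Coordinates.

Lemma nbhs_initial (S : choiceType) (T : topologicalType) (f : S -> T)
    (s : initial_topology f) (A : set S) :
  nbhs s A <-> exists2 B, nbhs (f s) B & f @^-1` B `<=` A.
Proof.
split=> [[_ [[B oB <-] Bs BA]]|[B nB BA]].
  by exists B => //; apply: open_nbhs_nbhs.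
by apply: filterS BA _; exact: (@initial_continuous _ _ f s).
Qed.

(** For [Grass], this reduces convergence of subspaces to convergence of their projection
    matrices. *)
Lemma cvg_initial (S : choiceType) (T : topologicalType) (f : S -> T)
    (X : Type) (F : set_system X) (FF : Filter F) (g : X -> initial_topology f)
    (s : initial_topology f) :
  g @ F --> s <-> f (g x) @[x --> F] --> f s.
Proof.
split=> [gs|fgs A /nbhs_initial[B nB BA]].
  by apply: (cvg_comp _ _ gs); exact: (@initial_continuous _ _ f s).
have FB : F ((fun x => f (g x)) @^-1` B) by exact: fgs nB.
by apply: filterS FB => x; exact: BA.
Qed.

(** * The symplectic form and the flow *)

Section LagrangianMatrices.
Variables (C : numClosedFieldType) (N : nat) (J : 'M[C]_N).
Implicit Types P Q g S : 'M[C]_N.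

Definition lagmx P := (P *m J :=: 1%:M - P)%MS.
(** Such g preserve the sesquilinear form with matrix J, for which a subspace satisfying [lagmx] is
    its own orthogonal. *)
Definition sympmx g := g *m J *m g^t* = J.

(** With h the adjoint of the inverse of g, the symplectic condition reads g J = J h. Hence Q J, P g
    J = P J h, (1 - P) h and 1 - Q share one row space, the last step being [eqmx_orthoC]. *)
Lemma lagmx_move P Q g : orthoprojmx P -> orthoprojmx Q -> g \in unitmx ->
  sympmx g -> (P *m g :=: Q)%MS -> lagmx P -> lagmx Q.
Proof.
move=> oP oQ ug sg PgQ lP.
have gJ : g *m J = J *m (invmx g)^t*.
  by rewrite -{2}sg -invmx_trmxC mulmxK // unitmx_trmxC.
apply: (eqmx_trans _ (eqmx_orthoC oP oQ ug PgQ)).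
apply: (eqmx_trans (eqmx_sym (eqmxMr J PgQ))).
by rewrite -mulmxA gJ mulmxA; exact: eqmxMr.
Qed.

Variable P0 : 'M[C]_N.
Hypothesis oP0 : orthoprojmx P0.
Hypothesis P0J : P0 *m J = J *m (1%:M - P0).

Let JP0 : J *m P0 = (1%:M - P0) *m J.
Proof. by rewrite mulmxBl mul1mx P0J mulmxBr mulmx1 opprB addrC subrK. Qed.

(** The rows of S are orthogonal to the row space of P0, and J maps that complement into the row
    space. The three identities evaluate the terms in the expansion of the form on a graph. *)
Let graphmx_J S : graphmx P0 S ->
  [/\ S *m J *m P0 = S *m J, P0 *m J *m S^t* = J *m S^t* &
      S *m J *m S^t* = 0].
Proof.
move=> [e1 e2].
have P0S : P0 *m S^t* = 0 by rewrite -{1}oP0.1 -trmxCM e2 trmx0 map_mx0.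
have SJP0 : S *m J *m P0 = S *m J.
  by rewrite -mulmxA JP0 mulmxA mulmxBr mulmx1 e2 subr0.
split=> //.
  by rewrite P0J mulmxBr mulmx1 mulmxBl -mulmxA P0S mulmx0 subr0.
by rewrite -SJP0 -mulmxA P0S mulmx0.
Qed.

Lemma graphmx_symp S : graphmx P0 S ->
  S *m J + J *m S^t* = 0 -> sympmx (1%:M + S).
Proof.
move=> gS SJ; have [_ _ SJS] := graphmx_J gS.
rewrite /sympmx raddfD /= map_mxD trmx1 map_mx1 mulmxDl mul1mx.
by rewrite mulmxDr mulmx1 mulmxDl SJS addr0 -addrA SJ addr0.
Qed.

(** A Lagrangian is isotropic, so the form with matrix J vanishes on the rows of P0 + S. The terms
    of degree 0 and 2 in S vanish by themselves; the linear ones are the stated condition. *)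
Lemma lagmx_graph P S : orthoprojmx P -> graphmx P0 S ->
  ((P0 + S)%R :=: P)%MS -> lagmx P -> S *m J + J *m S^t* = 0.
Proof.
move=> oP gS PS lP; have [e1 e2 e3] := graphmx_J gS.
have P0JP0 : P0 *m J *m P0 = 0.
  by rewrite P0J -mulmxA mulmxBl mul1mx oP0.2 subrr mulmx0.
have /(submx_orthoproj _ oP) XP : ((P0 + S)%R <= P)%MS by rewrite PS.
have /(submx_orthoprojC _ oP) XJP : ((P0 + S)%R *m J <= 1%:M - P)%MS.
  by rewrite -lP; apply: submxMr; rewrite PS.
have : (P0 + S) *m J *m (P0 + S)^t* = 0.
  by rewrite -{2}XP trmxCM oP.1 mulmxA XJP mul0mx.
rewrite raddfD /= map_mxD oP0.1 mulmxDl mulmxDr !mulmxDl.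
by rewrite P0JP0 e1 e2 e3 add0r addr0.
Qed.

End LagrangianMatrices.

(** * Splitting a matrix by the signs of the weight differences *)

Section NegativePart.
Variables (R : realType) (C : numClosedFieldType) (N : nat) (d : 'I_N -> R).
Implicit Types S : 'M[C]_N.

(** These are the entries that decay under conjugation by the flow with weights [d] as t tends to
    +oo; in the chart at Lambda_K they form the part tangent to W_K^-. *)
Definition negpart S : 'M[C]_N := \matrix_(a, b) if d a < d b then S a b else 0.

Lemma negpart_lt S a b : negpart S a b != 0 -> d a < d b.
Proof. by rewrite mxE; case: ifP => // _; rewrite eqxx. Qed.

Lemma negpart_graphmx (v : 'rV[C]_N) S :
  graphmx (diag_mx v) S -> graphmx (diag_mx v) (negpart S).
Proof.
move=> [/matrixP e1 /matrixP e2]; split; apply/matrixP => a b.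
  have := e1 a b; rewrite !mul_diag_mx !mxE.
  by case: ifP => // _ _; rewrite mulr0.
have := e2 a b; rewrite !mul_mx_diag !mxE.
by case: ifP => // _ _; rewrite mul0r.
Qed.

(** J pairs opposite weights, so at position (a, b) both truncations, of S J and of J S^*, amount to
    the same symmetric test d a + d b < 0. The linear condition can therefore be truncated entry by
    entry. *)
Lemma negpart_symp (J S : 'M[C]_N) :
  (forall a b, J a b != 0 -> d a + d b = 0) ->
  S *m J + J *m S^t* = 0 -> negpart S *m J + J *m (negpart S)^t* = 0.
Proof.
move=> dJ /matrixP SJ; apply/matrixP => a b.
have eqS : (negpart S *m J) a b = if d a + d b < 0 then (S *m J) a b else 0.
  rewrite !mxE; case: ifPn => dab; [apply: eq_bigr|apply: big1] => c _;
  rewrite mxE; have [->|/dJ dcb] := eqVneq (J c b) 0; rewrite ?mulr0 //;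
  have -> : (d a < d c) = (d a + d b < 0) by
    rewrite -subr_lt0 -[d b]opprK -(addr0_eq dcb) opprK.
    by rewrite dab.
  by rewrite (negPf dab) mul0r.
have eqJ : (J *m (negpart S)^t* ) a b =
    if d a + d b < 0 then (J *m S^t* ) a b else 0.
  rewrite !mxE; case: ifPn => dab; [apply: eq_bigr|apply: big1] => c _;
  rewrite !mxE; have [->|/dJ dac] := eqVneq (J a c) 0; rewrite ?mul0r //;
  have -> : (d b < d c) = (d a + d b < 0) by
    rewrite -subr_lt0 addrC -(addr0_eq dac) opprK.
    by rewrite dab.
  by rewrite (negPf dab) conjC0 mulr0.
rewrite mxE eqS eqJ; have := SJ a b; rewrite !mxE.
by case: ifP => // _ _; rewrite addr0.
Qed.

End NegativePart.

Section RealComplex.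
Context {R : realType} {T : Type} {F : set_system T} {FF : Filter F}.
Local Notation C := (R[i] : numClosedFieldType).

Lemma cvg_real_complex (f : T -> R) (l : R) :
  f @ F --> l -> ((f x)%:C : C) @[x --> F] --> (l%:C : C).
Proof.
move=> fl; apply/cvgrPdist_lt => e e0.
(* A positive element of R[i] is real, so its real part can serve as the bound in R. *)
have eE : (complex.Re e)%:C = e by apply: RRe_real; exact: gtr0_real.
have Re0 : 0 < complex.Re e by rewrite -ltcR eE.
have /cvgrPdist_lt/(_ _ Re0) := fl.
apply: filterS => x; rewrite -rmorphB normc_def /= expr0n addr0 sqrtr_sqr.
by rewrite -[X in _ -> _ < X]eE ltcR.
Qed.

End RealComplex.

(** * Diagonal flows and their action by conjugation *)

Section DiagonalFlow.
Variables (R : realType) (N : nat).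
Local Notation C := (R[i] : numClosedFieldType).
Implicit Types (d : 'I_N -> R) (S : 'M[C]_N).

Definition flowmx d (t : R) : 'M[C]_N :=
  diag_mx (\row_a ((expR (t * d a))%:C : C)).

Lemma flowmxD d s t : flowmx d s *m flowmx d t = flowmx d (s + t).
Proof.
rewrite mulmx_diag; congr diag_mx; apply/rowP => a.
by rewrite !mxE mulrDl expRD rmorphM.
Qed.

Lemma flowmx0 d : flowmx d 0 = 1%:M.
Proof.
rewrite -diag_const_mx; congr diag_mx; apply/rowP => a.
by rewrite !mxE mul0r expR0.
Qed.

Lemma flowmxN d t : flowmx d (- t) = flowmx (fun a => - d a) t.
Proof. by congr diag_mx; apply/rowP => a; rewrite !mxE mulrN mulNr. Qed.

Lemma flowmxNN d t : flowmx (fun a => - d a) (- t) = flowmx d t.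
Proof. by congr diag_mx; apply/rowP => a; rewrite !mxE mulrNN. Qed.

Lemma flowmxK d t : flowmx d t *m flowmx d (- t) = 1%:M.
Proof. by rewrite flowmxD subrr flowmx0. Qed.

Lemma flowmxVK d t : flowmx d (- t) *m flowmx d t = 1%:M.
Proof. by rewrite flowmxD addNr flowmx0. Qed.

Lemma flowmx_unit d t : flowmx d t \in unitmx.
Proof. by case/mulmx1_unit : (flowmxK d t). Qed.

Lemma flowmx_conjE d t S a b :
  (flowmx d t *m S *m flowmx d (- t)) a b = (expR (t * (d a - d b)))%:C * S a b.
Proof.
rewrite mul_mx_diag mxE mul_diag_mx !mxE mulrAC -rmorphM -expRD.
by rewrite mulNr mulrBr.
Qed.

Lemma flowmx_trmxC d t : (flowmx d t)^t* = flowmx d t.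
Proof.
rewrite tr_diag_mx map_diag_mx; congr diag_mx; apply/rowP => a; rewrite !mxE.
by apply: CrealP; rewrite -[_ \is _]/(_ \is Num.real) realE lecR expR_ge0.
Qed.

Lemma flowmx_symp d (J : 'M[C]_N) t :
  (forall a b, J a b != 0 -> d a + d b = 0) -> sympmx J (flowmx d t).
Proof.
move=> dJ; rewrite /sympmx flowmx_trmxC; apply/matrixP => a b.
rewrite mul_mx_diag mxE mul_diag_mx !mxE.
have [->|/dJ dab] := eqVneq (J a b) 0; first by rewrite mulr0 mul0r.
by rewrite mulrAC -rmorphM -expRD -mulrDr dab mulr0 expR0 mul1r.
Qed.

Lemma cvg_flowmx_conj d S : (forall a b, S a b != 0 -> d a < d b) ->
  flowmx d t *m S *m flowmx d (- t) @[t --> +oo] --> (0 : 'M[C]_N).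
Proof.
move=> dS; apply/cvg_mxP => a b; under eq_fun do rewrite flowmx_conjE.
rewrite mxE; have [->|/dS dab] := eqVneq (S a b) 0.
  by under eq_fun do rewrite mulr0; exact: cvg_cst.
rewrite -[0 : C](mul0r (S a b)); apply: cvgMr_tmp.
have -> : (0 : C) = (0 : R)%:C by [].
apply: cvg_real_complex.
have : (t * (d b - d a)) @[t --> +oo] --> (+oo : set_system R).
  by apply: gt0_cvgMly; rewrite ?subr_gt0.
move=> /cvg_comp/(_ (@cvgr_expR R)); apply: cvg_trans.
by apply: near_eq_cvg; near=> t; rewrite /= -mulrN opprB.
Unshelve. all: by end_near. Qed.

(** If d b <= d a, the factor exp(t (d a - d b)) of entry (a, b) is at least 1 for t >= 0, so a
    nonzero entry stays away from 0. *)
Lemma flowmx_conj_neq0 d S :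
  flowmx d t *m S *m flowmx d (- t) @[t --> +oo] --> (0 : 'M[C]_N) ->
  forall a b, S a b != 0 -> d a < d b.
Proof.
move=> /cvg_mxP cS a b Sab; rewrite ltNge; apply/negP => dba.
have Sab0 : 0 < `|S a b| by rewrite normr_gt0.
have /cvgrPdist_lt/(_ _ Sab0) := cS a b.
move=> /(filterI (nbhs_pinfty_ge (num_real (0 : R))))/filter_ex[t [/= t0]].
rewrite mxE sub0r normrN flowmx_conjE normrM.
move=> /lt_geF/negbT/negP; apply; apply: ler_peMl => //.
rewrite normc_def /= expr0n addr0 sqrtr_sqr.
rewrite ger0_norm ?expR_ge0 // lecR -[1]expR0 ler_expR.
by rewrite mulr_ge0 ?subr_ge0.
Qed.

Lemma expmx_diag (x : 'I_N -> R) :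
  expmx (diag_mx (\row_a ((x a)%:C : C))) =
  diag_mx (\row_a ((expR (x a))%:C : C)).
Proof.
apply: cvg_lim; first exact: norm_hausdorff.
apply/cvg_mxP => a b; rewrite !mxE.
have powE k : diag_mx (\row_a ((x a)%:C : C)) ^+ k =
              diag_mx (\row_a ((x a ^+ k)%:C : C)).
  elim: k => [|k IHk].
    rewrite expr0 -[LHS]diag_const_mx; congr diag_mx.
    by apply/rowP => c; rewrite !mxE expr0.
  rewrite exprS IHk -[LHS]/(_ *m _) mulmx_diag; congr diag_mx; apply/rowP => c.
  by rewrite !mxE exprS rmorphM.
have serE n : series (fun k : nat => (k`!%:R)^-1 *:
    diag_mx (\row_a ((x a)%:C : C)) ^+ k) n a b =
    ((series (exp_coeff (x a)) n)%:C : C) *+ (a == b).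
  rewrite /series /= summxE rmorph_sum -sumrMnl; apply: eq_bigr => k _.
  rewrite powE !mxE /exp_coeff /=; case: eqP => [->|_].
    by rewrite !mulr1n rmorphM /= fmorphV rmorph_nat mulrC.
  by rewrite !mulr0n mulr0.
under eq_fun do rewrite serE.
case: eqP => [_|_]; last by rewrite mulr0n; exact: cvg_cst.
rewrite mulr1n; apply: cvg_real_complex; exact: is_cvg_series_exp_coeff.
Qed.

End DiagonalFlow.

(** * The hermitian Lagrangian Grassmannian *)

Section LagrangianGrassmannian.
Variables (R : realType) (n : nat) (E : vectType R[i]).
Variables (form : {dot E for conjC}) (e : n.-tuple E).
Hypothesis e_basis : basis_of fullv e.
Hypothesis e_orthonormal : orthonormal form e.
Local Notation C := (R[i] : numClosedFieldType).
Local Notation b := (hat_basis e).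

Lemma tnth_hat_basis (a : 'I_(n + n)) :
  tnth b a = match fintype.split a with inl i => bfe e i | inr j => bff e j end.
Proof.
rewrite /hat_basis (tnth_nth 0) /= nth_cat size_map size_enum_ord.
case: splitP => i ->; rewrite ?addKn (nth_map i) ?size_enum_ord //;
by rewrite nth_ord_enum.
Qed.

Lemma tnth_lshift i : tnth b (lshift n i) = bfe e i.
Proof. by rewrite tnth_hat_basis (unsplitK (inl i)). Qed.

Lemma tnth_rshift i : tnth b (rshift n i) = bff e i.
Proof. by rewrite tnth_hat_basis (unsplitK (inr i)). Qed.

Lemma form_tnth i j : form (tnth e i) (tnth e j) = (i == j)%:R.
Proof.
have /orthonormalP[ue eo] := e_orthonormal.
by rewrite eo ?mem_tnth // !(tnth_nth 0) nth_uniq ?size_tuple.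
Qed.

Lemma hat_form_tnth a c : hat_form form (tnth b a) (tnth b c) = (a == c)%:R.
Proof.
rewrite -[a]splitK -[c]splitK.
case: (fintype.split a) (fintype.split c) => [k|k] [l|l] /=;
rewrite ?tnth_lshift ?tnth_rshift /hat_form /= ?linear0r ?linear0l ?form_tnth.
- by rewrite addr0 (inj_eq (@lshift_inj _ _)).
- by rewrite addr0 eq_lrshift.
- by rewrite addr0 eq_rlshift.
- by rewrite add0r (inj_eq (@rshift_inj _ _)).
Qed.

Lemma hat_basis_basis : basis_of fullv b.
Proof.
have buniq : uniq b.
  apply/(tuple_uniqP b) => i j bij; apply/eqP; move: (hat_form_tnth i j).
  rewrite bij hat_form_tnth eqxx; case: eqP => // _ /eqP.
  by rewrite oner_eq0.
have bfree : free b.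
  apply: (@orthonormal_free _ _ (hat_form form)).
  apply/orthonormalP; split; first exact: buniq.
  move=> _ _ /tnthP[i ->] /tnthP[j ->]; apply: (etrans (hat_form_tnth i j)).
  by rewrite !(tnth_nth 0) nth_uniq ?size_tuple.
rewrite basisEfree bfree subvf /= size_tuple dimvf /dim /=.
by rewrite -dimvf (size_basis e_basis) card_ord leqnn.
Qed.


Local Notation grass := (hatGrass form e).
Local Notation pmx L := (projmx b (hat_form form) (L : {vspace E * E})).

Let b_basis := hat_basis_basis.
Let b_orthonormal := hat_form_tnth.

Lemma orthoproj_pmx (L : grass) : orthoprojmx (pmx L).
Proof. exact: (orthoprojmx_projmx b_basis b_orthonormal). Qed.

Lemma pmx_inj (L L' : grass) : (pmx L :=: pmx L')%MS -> L = L'.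
Proof. exact: (projmx_inj b_basis b_orthonormal). Qed.

(** With row coordinates this is a right action: [act h] followed by [act g] is [act (h *m g)]. *)
Definition act (g : 'M[C]_(n + n)) (L : grass) : grass :=
  (lfun_of_mx b g @: (L : {vspace E * E}))%VS.

Lemma pmx_act g (L : grass) : (pmx L *m g :=: pmx (act g L))%MS.
Proof.
have := projmx_limg b_basis b_orthonormal (L : {vspace E * E}) (lfun_of_mx b g).
by rewrite lfun_of_mxK //; exact: b_basis.
Qed.

Lemma act_eq g (L L' : grass) : (pmx L *m g :=: pmx L')%MS -> act g L = L'.
Proof.
by move=> gL; apply: pmx_inj; apply: eqmx_trans gL; apply/eqmx_sym/pmx_act.
Qed.

Lemma cvg_act T (F : set_system T) (FF : Filter F)
    (L : T -> grass) (g : T -> 'M[C]_(n + n))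
    (L0 : grass) (g0 : 'M[C]_(n + n)) :
  L @ F --> L0 -> g @ F --> g0 -> g0 \in unitmx ->
  act (g x) (L x) @[x --> F] --> act g0 L0.
Proof.
move=> /cvg_initial cL cg ug0; apply/cvg_initial.
have := @cvg_orthoproj C _ T F FF (fun x => pmx (L x))
  (fun x => pmx (act (g x) (L x))) g (pmx L0) (pmx (act g0 L0)) g0
  (fun x => orthoproj_pmx _) (fun x => orthoproj_pmx _) (orthoproj_pmx L0)
  (orthoproj_pmx _) ug0 (fun x _ => pmx_act _ _) (pmx_act _ _).
by move=> /(_ cL)/(_ cg).
Qed.

(* In row coordinates e_i J = f_i and f_i J = - e_i. *)
Definition Jmx : 'M[C]_(n + n) := block_mx 0 1%:M (- 1%:M) 0.

Lemma Jmx_neq0 a c : Jmx a c != 0 ->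
  match fintype.split a, fintype.split c with
  | inl i, inr j | inr i, inl j => i = j
  | _, _ => False
  end.
Proof.
rewrite -{1}[a]splitK -{1}[c]splitK /Jmx.
case: (fintype.split a) (fintype.split c) => i [] j /=;
rewrite ?block_mxEul ?block_mxEur ?block_mxEdl ?block_mxEdr !mxE ?eqxx //.
  by case: (i =P j) => //; rewrite mulr0n eqxx.
by case: (i =P j) => //; rewrite mulr0n oppr0 eqxx.
Qed.

Lemma Jmx_unit : Jmx \in unitmx.
Proof.
have : Jmx *m block_mx 0 (- 1%:M) 1%:M 0 = 1%:M.
  rewrite mulmx_block !mulmx0 !mul0mx !mulmx1 mulmxN mulNmx mulmx1 opprK.
  by rewrite !addr0 !add0r -scalar_mx_block.
by case/mulmx1_unit.
Qed.

Lemma mx_of_hatJ : mx_of_lfun b (linfun (@hatJ C E)) = Jmx.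
Proof.
apply/row_matrixP => a; rewrite rowE -(coords_tnth b_basis) -coords_lfun //.
rewrite lfunE /= -[a]splitK; case: (fintype.split a) => i /=.
  rewrite tnth_lshift /hatJ /= oppr0 -[(0, _)]/(bff e i) -tnth_rshift.
  rewrite (coords_tnth b_basis); apply/rowP => c.
  rewrite [RHS]mxE -[c]splitK /Jmx; case: (fintype.split c) => j /=.
    by rewrite block_mxEul !mxE eqxx eq_lrshift.
  by rewrite block_mxEur !mxE eqxx (inj_eq (@rshift_inj _ _)) eq_sym.
rewrite tnth_rshift; have -> : hatJ (bff e i) = - tnth b (lshift n i).
  by rewrite tnth_lshift /hatJ /bff /bfe /= -[RHS]/(- _, - 0) oppr0.
have -> : coords b (- tnth b (lshift n i)) = - coords b (tnth b (lshift n i)).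
  by apply/rowP => c; rewrite !mxE linearN.
rewrite (coords_tnth b_basis); apply/rowP => c.
rewrite [RHS]mxE -[c]splitK /Jmx; case: (fintype.split c) => j /=.
  by rewrite block_mxEdl !mxE eqxx (inj_eq (@lshift_inj _ _)) eq_sym.
by rewrite block_mxEdr !mxE eqxx eq_rlshift oppr0.
Qed.

Lemma LagP (L : grass) : Lag form e L <-> lagmx Jmx (pmx L).
Proof.
rewrite /lagmx -mx_of_hatJ.
have cE v : (coords b v <= 1%:M - pmx L)%MS = (v \in orthov (hat_form form) L).
  exact: (submx_projmxC b_basis b_orthonormal).
have iE v : (coords b v <= pmx L *m mx_of_lfun b (linfun (@hatJ C E)))%MS =
    (v \in (linfun (@hatJ C E) @: (L : {vspace E * E}))%VS).
  exact: (submx_projmx_limg b_basis b_orthonormal).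
split=> [LagL|lagL].
  by apply: (eqmx_coords b_basis) => v; rewrite cE iE LagL.
by rewrite /Lag /=; apply/vspaceP => v; rewrite -cE -iE lagL.
Qed.


(** * The coordinate Lagrangians Lambda_I *)

Definition ind (I : {set 'I_n}) (a : 'I_(n + n)) : bool :=
  match fintype.split a with inl i => i \in I | inr j => j \notin I end.

Definition Pmx I : 'M[C]_(n + n) := diag_mx (\row_a ((ind I a)%:R : C)).

Lemma orthoproj_Pmx I : orthoprojmx (Pmx I).
Proof.
split; apply/matrixP => a c.
  rewrite !mxE rmorphMn rmorph_nat /= eq_sym.
  by case: eqP => [->|].
rewrite /Pmx mulmx_diag !mxE -natrM mulnb andbb.
by case: eqP => // ->.
Qed.

(** J exchanges e_i and f_i up to sign, and exactly one of the two lies in Lambda_I. *)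
Lemma Pmx_J I : Pmx I *m Jmx = Jmx *m (1%:M - Pmx I).
Proof.
move: Jmx Jmx_neq0 => J JE.
rewrite mulmxBr mulmx1 /Pmx mul_diag_mx mul_mx_diag.
apply/matrixP => a c; rewrite !mxE.
have [->|/JE] := eqVneq (J a c) 0; first by rewrite mulr0 mul0r subrr.
rewrite /ind; case: (fintype.split a) (fintype.split c) => i [] j //= <-;
by case: (i \in I); rewrite ?mul1r ?mulr1 ?mulr0 ?mul0r ?subrr ?subr0.
Qed.

Lemma pmx_Lambda I : pmx (Lambda form e I) = Pmx I.
Proof.
apply: (orthoprojmx_inj (orthoproj_pmx _) (orthoproj_Pmx I)).
have memE v : v \in (Lambda form e I : {vspace E * E}) ->
    coords b v *m (1%:M - Pmx I) = 0.
  move=> vL.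
  (* Phrased as inclusion in a kernel, the claim need only be checked on the generators of
     Lambda_I. *)
  suff /subvP/(_ _ vL) : ((Lambda form e I : {vspace E * E}) <=
       lker (lfun_of_mx b (1%:M - Pmx I)))%VS.
    rewrite memv_ker => /eqP v0.
    rewrite -(lfun_of_mxK b_basis (1%:M - Pmx I)) -(coords_lfun b_basis) v0.
    by apply/rowP => c; rewrite !mxE linear0.
  have kerE a : ind I a -> tnth b a \in lker (lfun_of_mx b (1%:M - Pmx I)).
    move=> Ia; rewrite memv_ker; apply/eqP/(can_inj (coordsK b_basis)).
    rewrite coords_lfun // lfun_of_mxK // coords_tnth //.
    rewrite mulmxBr mulmx1 /Pmx mul_mx_diag.
    apply/rowP => c; rewrite !mxE linear0.
    rewrite eqxx /=; have [->|_] := eqVneq c a; last by rewrite mul0r subrr.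
    by rewrite Ia mulr1 subrr.
  apply/span_subvP => w; rewrite mem_cat.
  case/orP => /mapP[k]; rewrite mem_enum => Ik ->.
    by rewrite -tnth_lshift; apply: kerE; rewrite /ind (unsplitK (inl k)).
  rewrite -tnth_rshift; apply: kerE; rewrite /ind (unsplitK (inr k)).
  by rewrite inE in Ik.
apply/eqmxP/andP; split; apply/row_subP => a.
  rewrite -[row a _](of_coordsK b_basis); set v := of_coords _ _.
  apply/(submx_orthoproj _ (orthoproj_Pmx I)).
  have : v \in (Lambda form e I : {vspace E * E}).
    by rewrite -(submx_projmx b_basis b_orthonormal) of_coordsK // row_sub.
  by move/memE; rewrite mulmxBr mulmx1 => /eqP; rewrite subr_eq0 => /eqP <-.
have -> : row a (Pmx I) = (ind I a)%:R *: coords b (tnth b a).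
  by rewrite coords_tnth // row_diag_mx mxE.
case Ia : (ind I a); last by rewrite scale0r sub0mx.
rewrite scale1r (submx_projmx b_basis b_orthonormal).
apply: memv_span; rewrite mem_cat tnth_hat_basis; move: Ia; rewrite /ind.
case: (fintype.split a) => k Ik; apply/orP; [left|right]; apply: map_f;
by rewrite mem_enum ?inE.
Qed.

(** * The flow on the Lagrangians and the sets W_M^- *)

Variables (alpha : 'I_n -> R) (alpha_gt0 : forall i, 0 < alpha i).
Hypothesis alpha_lt : forall i j : 'I_n, (i < j)%N -> alpha i < alpha j.
Variable Ahat : 'End((E * E)%type).
Hypothesis Ahat_e : forall i, Ahat (bfe e i) = (alpha i)%:C *: bfe e i.
Hypothesis Ahat_f : forall i, Ahat (bff e i) = - (alpha i)%:C *: bff e i.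

Definition weight (a : 'I_(n + n)) : R :=
  match fintype.split a with inl i => alpha i | inr j => - alpha j end.

Let alpha_inj : injective alpha.
Proof.
move=> i j ij; apply/val_inj; case: (ltngtP i j) => // /alpha_lt;
by rewrite ij ltxx.
Qed.

Lemma weight_inj : injective weight.
Proof.
move=> a c; rewrite /weight -{2}[a]splitK -{2}[c]splitK.
case: (fintype.split a) (fintype.split c) => i [] j.
- by move/alpha_inj ->.
- move=> ij; have := alpha_gt0 i; rewrite ij oppr_gt0.
  by move/lt_trans/(_ (alpha_gt0 j)); rewrite ltxx.
- move=> ij; have := alpha_gt0 j; rewrite -ij oppr_gt0.
  by move/lt_trans/(_ (alpha_gt0 i)); rewrite ltxx.
- by move/oppr_inj/alpha_inj ->.
Qed.

Lemma Jmx_weight a c : Jmx a c != 0 -> weight a + weight c = 0.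
Proof.
move/Jmx_neq0; rewrite /weight.
by case: (fintype.split a) (fintype.split c) => i [] j // ->;
  rewrite ?subrr ?addNr.
Qed.

Lemma mx_of_Ahat t : mx_of_lfun b ((t%:C : C) *: Ahat) =
  diag_mx (\row_a ((t * weight a)%:C : C)).
Proof.
apply/row_matrixP => a; rewrite rowE -(coords_tnth b_basis) -coords_lfun //.
rewrite row_diag_mx mxE -(coords_tnth b_basis) lfunE /= rmorphM.
have -> : Ahat (tnth b a) = (weight a)%:C *: tnth b a.
  rewrite -[a]splitK /weight; case: (fintype.split a) => i /=.
    by rewrite (unsplitK (inl i)) tnth_lshift Ahat_e.
  by rewrite (unsplitK (inr i)) tnth_rshift Ahat_f rmorphN.
by rewrite scalerA; apply/rowP => c; rewrite !mxE linearZ.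
Qed.

Lemma PsiE t (L : grass) : Psi Ahat t L = act (flowmx weight t) L.
Proof. by rewrite /Psi /act /exp_lfun mx_of_Ahat expmx_diag. Qed.

Local Notation D := (flowmx weight).

(** Moving g past the flow gives Psi^{-t}(L g) = (Psi^{-t} L)(D t g D(-t)), which tends to Lambda_M
    h = Lambda_M by joint continuity of the action. *)
Lemma Wminus_act M (L : grass) g h : Wminus form e Ahat M L ->
  g \in unitmx -> sympmx Jmx g -> h \in unitmx ->
  (Pmx M *m h :=: Pmx M)%MS ->
  D t *m g *m D (- t) @[t --> +oo] --> h -> Wminus form e Ahat M (act g L).
Proof.
move=> [lagL cL] ug sg uh hM cg; split.
  apply/LagP; apply: (lagmx_move _ _ ug sg (pmx_act g L)).
  - exact: orthoproj_pmx.
  - exact: orthoproj_pmx.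
  - exact/LagP.
have <- : act h (Lambda form e M) = Lambda form e M.
  by apply: act_eq; rewrite pmx_Lambda.
have gE t : Psi Ahat (- t) (act g L) =
    act (D t *m g *m D (- t)) (Psi Ahat (- t) L).
  apply/esym/act_eq; rewrite !PsiE.
  apply: eqmx_trans (pmx_act _ _).
  apply: eqmx_trans (eqmxMr _ (pmx_act _ _)).
  apply: eqmx_trans (eqmxMr _ (eqmx_sym (pmx_act _ _))) _.
  by rewrite -!mulmxA [D (- t) *m (D t *m _)]mulmxA flowmxVK mul1mx mulmxA.
under eq_fun do rewrite gE.
exact: cvg_act.
Qed.

Let Pmx_flow K t : Pmx K *m D t = D t *m Pmx K.
Proof. exact: diag_mxC. Qed.

Lemma graphmx_flow K S s t :
  graphmx (Pmx K) S -> graphmx (Pmx K) (D s *m S *m D t).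
Proof.
move=> [e1 e2]; split.
  by rewrite !mulmxA Pmx_flow -[D s *m _ *m S]mulmxA e1.
by rewrite -!mulmxA -Pmx_flow [S *m _]mulmxA e2 mul0mx mulmx0.
Qed.

(** Multiplying on the left by the invertible D(-t) keeps the row space and turns P D(t) back into
    P, since both are diagonal. *)
Lemma graph_flow K S t :
  ((Pmx K + S)%R *m D t :=: (Pmx K + (D (- t) *m S *m D t))%R)%MS.
Proof.
apply: eqmx_trans (eqmx_sym (eqmx_unitl _ (flowmx_unit weight (- t)))) _.
rewrite mulmxA mulmxDr mulmxDl.
by rewrite -[D (- t) *m _ *m _]mulmxA Pmx_flow mulmxA flowmxVK mul1mx.
Qed.

(** For large t, Psi^{-t} L is close to Lambda_K and hence a graph; the flow preserves graphs, so L
    is one too. The chart of Psi^{-t} L is the conjugate D t S D(-t), and its convergence to 0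
    forces the sign of the weight differences. *)
Lemma Wminus_graph K (L : grass) : Wminus form e Ahat K L ->
  exists S : 'M[C]_(n + n), [/\ graphmx (Pmx K) S,
    ((Pmx K + S)%R :=: pmx L)%MS &
    forall a c, S a c != 0 -> weight a < weight c].
Proof.
move=> [lagL cL]; pose f t := pmx (Psi Ahat (- t) L).
have oP := orthoproj_Pmx K.
have cf : f t @[t --> +oo] --> Pmx K.
  by rewrite -pmx_Lambda; move/cvg_initial : cL.
pose S t := chart (Pmx K) (f t).
have nS : \forall t \near +oo, graphmx (Pmx K) (S t) /\
    ((Pmx K + (D (- t) *m S t *m D t))%R :=: pmx L)%MS.
  have nc : \forall t \near +oo, graphmx (Pmx K) (S t) /\
      ((Pmx K + S t)%R :=: f t)%MS.
    by apply: near_chart => // t; exact: orthoproj_pmx.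
  apply: filterS nc => t [gS PS].
  split; first exact: gS.
  apply: eqmx_trans (eqmx_sym (graph_flow _ _ _)) _.
  apply: eqmx_trans (eqmxMr _ PS) _.
  rewrite /f PsiE; apply: eqmx_trans (eqmxMr _ (eqmx_sym (pmx_act _ _))) _.
  by rewrite -mulmxA flowmxVK mulmx1; exact: eqmx_refl.
have [t0 [gS0 PS0]] := filter_ex nS.
exists (D (- t0) *m S t0 *m D t0); split; [exact: graphmx_flow|exact: PS0|].
apply: flowmx_conj_neq0.
have cS : S t @[t --> +oo] --> (0 : 'M[C]_(n + n)) by exact: cvg_chart.
apply: cvg_trans cS; apply: near_eq_cvg; apply: filterS nS => t [gS PS].
(* Both sides have L as their graph, and a graph determines its matrix. *)
have <- : D (- t) *m S t *m D t = D (- t0) *m S t0 *m D t0.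
  apply: (graphmx_inj oP); [exact: graphmx_flow|exact: graphmx_flow|].
  exact: eqmx_trans PS (eqmx_sym PS0).
have DK (A : 'M[C]_(n + n)) : D t *m (D (- t) *m A *m D t) *m D (- t) = A.
  by rewrite !mulmxA flowmxK mul1mx -mulmxA flowmxK mulmx1.
by rewrite DK.
Qed.

Lemma Wminus_shear K M (L : grass) S : Wminus form e Ahat M L ->
  graphmx (Pmx K) S -> S *m Jmx + Jmx *m S^t* = 0 ->
  (forall a c, S a c != 0 -> weight a < weight c) ->
  Wminus form e Ahat M (act (1%:M + S) L).
Proof.
move=> ML gS SJ wS; apply: (Wminus_act ML (h := 1%:M)).
- exact: graphmx_unit gS.
- exact: graphmx_symp (orthoproj_Pmx K) (Pmx_J K) _ gS SJ.
- exact: unitmx1.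
- by rewrite mulmx1; exact: eqmx_refl.
under eq_fun do rewrite mulmxDr mulmx1 mulmxDl flowmxK.
have : (1%:M + D t *m S *m D (- t)) @[t --> +oo] -->
    (1%:M + 0 : 'M[C]_(n + n)).
  by apply: cvgD; [exact: cvg_cst|exact: cvg_flowmx_conj].
by rewrite addr0.
Qed.

(** The matrix D s commutes with the flow, so its conjugates are constant, and it fixes Lambda_M. *)
Lemma Wminus_Psi M (L : grass) s : Wminus form e Ahat M L ->
  Wminus form e Ahat M (Psi Ahat s L).
Proof.
move=> ML; rewrite PsiE; apply: (Wminus_act ML (h := D s)).
- exact: flowmx_unit.
- exact: flowmx_symp Jmx_weight.
- exact: flowmx_unit.
- by rewrite Pmx_flow; apply: eqmx_unitl; exact: flowmx_unit.
have DE t : D t *m D s *m D (- t) = D s by rewrite !flowmxD addrAC subrr add0r.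
by under eq_fun do rewrite DE; exact: cvg_cst.
Qed.

Lemma act_shear_Lambda K (L : grass) S : graphmx (Pmx K) S ->
  ((Pmx K + S)%R :=: pmx L)%MS -> act (1%:M + S) (Lambda form e K) = L.
Proof.
by move=> gS SL; apply: act_eq; rewrite pmx_Lambda graphmx_shear.
Qed.

Lemma Wminus_Lambda K : Wminus form e Ahat K (Lambda form e K).
Proof.
split.
  apply/LagP; rewrite /lagmx pmx_Lambda Pmx_J.
  by apply: eqmx_unitl; exact: Jmx_unit.
have LE t : Psi Ahat (- t) (Lambda form e K) = Lambda form e K.
  rewrite PsiE; apply: act_eq; rewrite pmx_Lambda Pmx_flow.
  by apply: eqmx_unitl; exact: flowmx_unit.
by under eq_fun do rewrite LE; exact: cvg_cst.
Qed.

(** * Connecting orbits and closures *)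

Lemma prec_closure K M : prec form e Ahat K M ->
  Wminus form e Ahat K `<=` closure_Lag (Wminus form e Ahat M).
Proof.
move=> [L [lagL cM cK]] L' KL'; split; last by case: KL'.
have [S [gS SL' wS]] := Wminus_graph KL'.
have SJ : S *m Jmx + Jmx *m S^t* = 0.
  apply: (lagmx_graph (orthoproj_Pmx K) (Pmx_J K) (orthoproj_pmx L') gS SL').
  by apply/LagP; case: KL'.
(* The shear that takes Lambda_K to L' is applied to the whole orbit of L, which tends to
   Lambda_K. *)
have : act (1%:M + S) (Psi Ahat t L) @[t --> +oo] --> L'.
  rewrite -(act_shear_Lambda gS SL').
  by apply: cvg_act => //; [exact: cvg_cst|exact: graphmx_unit gS].
move=> cL' B /cL' nB.
have {}nB : \forall t \near +oo, B (act (1%:M + S) (Psi Ahat t L)) by exact: nB.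
have [t Bt] := filter_ex nB.
exists (act (1%:M + S) (Psi Ahat t L)); split => //.
by apply: (Wminus_shear (K := K)) => //; exact: Wminus_Psi.
Qed.

Lemma closure_prec K M :
  Wminus form e Ahat K `<=` closure_Lag (Wminus form e Ahat M) ->
  prec form e Ahat K M.
Proof.
move=> /(_ _ (Wminus_Lambda K))[clK _].
have oP := orthoproj_Pmx K.
pose S (L : grass) := chart (Pmx K) (pmx L).
have nS : \forall L \near (Lambda form e K : grass), graphmx (Pmx K) (S L) /\
    ((Pmx K + S L)%R :=: pmx L)%MS.
  apply: (near_chart oP (nbhs_filter (Lambda form e K : grass))
    (f := fun L : grass => pmx L)) => [L|]; first exact: orthoproj_pmx.
  rewrite -pmx_Lambda.
  exact: (@initial_continuous _ _ _ (Lambda form e K : grass)).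
(* The domain of the chart is a neighbourhood of Lambda_K, so it meets W_M^-. *)
have [L [ML [gS SL]]] := clK _ nS.
move: (S L) gS SL => A gS SL {S nS}.
have SJ : A *m Jmx + Jmx *m A^t* = 0.
  apply: (lagmx_graph oP (Pmx_J K) (orthoproj_pmx L) gS SL).
  by apply/LagP; case: ML.
pose S' := negpart weight A.
have gS' : graphmx (Pmx K) S' by exact: negpart_graphmx.
have MS' : Wminus form e Ahat M (act (1%:M + - S') L).
  apply: (Wminus_shear (K := K)) => //; first exact: graphmxN.
    rewrite raddfN /= map_mxN mulNmx mulmxN -opprD negpart_symp ?oppr0 //.
    exact: Jmx_weight.
  by move=> a c; rewrite mxE oppr_eq0; exact: negpart_lt.
(* The part S_+ that remains once the shear by - S' has removed the negative part. *)
pose U := A - S'.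
have gU : graphmx (Pmx K) U by apply: graphmxD => //; exact: graphmxN.
have UL : ((Pmx K + U)%R :=: pmx (act (1%:M + - S') L))%MS.
  apply: eqmx_trans (pmx_act _ _).
  apply: eqmx_trans (eqmxMr _ SL).
  by rewrite (graphmx_shearD gS) //; exact: graphmxN.
(* With p the diagonal entry of [Pmx K] at a, the graph conditions give p A_aa = A_aa and A_aa p =
   0. *)
have diag0 a : A a a = 0.
  have [/matrixP/(_ a a) <- /matrixP/(_ a a)] := gS.
  by rewrite mul_mx_diag mul_diag_mx !mxE mulrC.
(* What survives has weight c <= weight a. Equality would mean a = c because the weights are
   distinct, and diagonal entries vanish. *)
have wU a c : U a c != 0 -> - weight a < - weight c.
  rewrite ltrN2 /U /S' !mxE; case: ifPn => [_|]; first by rewrite subrr eqxx.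
  rewrite -leNgt le_eqVlt => /predU1P[/weight_inj ->|//].
  by rewrite diag0 subrr eqxx.
exists (act (1%:M + - S') L); split; [by case: MS'|by case: MS'|].
(* The forward orbit is written as Lambda_K moved by shears, which tend to 1 because every entry of
   U decays in forward time. *)
have PsiL t : Psi Ahat t (act (1%:M + - S') L) =
    act (1%:M + D (- t) *m U *m D t) (Lambda form e K).
  apply/esym/act_eq; rewrite pmx_Lambda graphmx_shear; last exact: graphmx_flow.
  apply: eqmx_trans (eqmx_sym (graph_flow _ _ _)) _.
  by rewrite PsiE; apply: eqmx_trans (eqmxMr _ UL) (pmx_act _ _).
under eq_fun do rewrite PsiL.
rewrite -[X in nbhs X](_ : act (1%:M + 0) (Lambda form e K) = _); last first.
  by apply: act_eq; rewrite addr0 mulmx1; exact: eqmx_refl.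
apply: cvg_act; [exact: cvg_cst| |by rewrite addr0 unitmx1].
apply: cvgD; first exact: cvg_cst.
(* Negating all weights reverses time, so the contraction lemma applies to the forward flow as
   well. *)
under eq_fun do rewrite flowmxN -(flowmxNN weight).
exact: cvg_flowmx_conj.
Qed.

End LagrangianGrassmannian.

Theorem proposition4p6 (R : realType) (n : nat) (E : vectType R[i])
    (form : {dot E for conjC}) (e : n.-tuple E)
    (e_basis : basis_of fullv e) (e_orthonormal : orthonormal form e)
    (alpha : 'I_n -> R) (alpha_gt0 : forall i, 0 < alpha i)
    (alpha_lt : forall i j : 'I_n, (i < j)%N -> alpha i < alpha j)
    (Ahat : 'End((E * E)%type))
    (Ahat_e : forall i, Ahat (bfe e i) = (alpha i)%:C *: bfe e i)
    (Ahat_f : forall i, Ahat (bff e i) = - (alpha i)%:C *: bff e i)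
    (M K : {set 'I_n}) :
  prec form e Ahat K M <->
  Wminus form e Ahat K `<=` closure_Lag (Wminus form e Ahat M).
Proof.
split.
  exact: (prec_closure e_basis e_orthonormal Ahat_e Ahat_f).
exact: (closure_prec e_basis e_orthonormal alpha_gt0 alpha_lt Ahat_e Ahat_f).
Qed.
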